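(* Let $(L,\cdot)$ be a SAL with an A-subloop $S$ and Central-holomorph $H(L)$. Then $H(L)$ is a SKL if and only if $$(x\beta^{-1})J\cdot yJ=(x\cdot y\alpha^{-1})J\quad\text{for all }x,y\in S\qquad\text{and}\qquad \alpha\beta=\beta\alpha,$$ for all $\alpha,\beta\in A(S,\cdot)$. Hence, when these equivalent conditions hold, $L$ is a SKL.
   Context: Mappings are written on the right, so $\alpha\beta$ means first $\alpha$, then $\beta$. For a loop $(L,\cdot)$ let $Aum(L,\cdot)$ be its automorphism group. The holomorph $H(L)=(H,\circ)$ is the loop on the set $H$ of pairs $(\alpha,x)$ with $\alpha\in Aum(L,\cdot)$, $x\in L$, with operation $(\alpha,x)\circ(\beta,y)=(\alpha\beta,\ x\beta\cdot y)$. The symbol $x^{-1}$ denotes the two-sided inverse of $x$ (assumed to exist in $L$), and $J:x\mapsto x^{-1}$. The nucleus $N(L)$ is the set of $a\in L$ with $a\cdot xy=ax\cdot y$, $x\cdot ay=xa\cdot y$, $x\cdot ya=xy\cdot a$ for all $x,y\in L$; the centrum $C(L)$ is the set of $a\in L$ with $ax=xa$ for all $x\in L$; the center is $Z(L)=N(L)\cap C(L)$. $H(L)$ is called a Central-holomorph of $L$ if $x^{-1}\cdot x\alpha\in Z(L)$ or $x\alpha\cdot x^{-1}\in Z(L)$ for all $x\in L$ and $\alpha\in Aum(L,\cdot)$. For a subloop $S$ of $L$, $A(S,\cdot)=\{\alpha\in Aum(L,\cdot): s\alpha\in S\ \forall s\in S\}$ is the group of Smarandache loop automorphisms on $S$.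 An A-loop is a loop all of whose inner mappings (the elements of the multiplication group, generated by all left and right translations, that fix the identity element) are automorphisms. A loop has the automorphic inverse property (AIP) if $(xy)^{-1}=x^{-1}y^{-1}$ for all $x,y$. A K-loop is an A-loop with the AIP. A loop is a Smarandache A-loop (SAL) (resp. Smarandache K-loop (SKL)) if it has at least one non-trivial subloop that is an A-loop (resp. a K-loop); in ''a SAL with an A-subloop $S$'', $S$ is such a non-trivial subloop that is an A-loop.
   Formalization: In the equivalence, ''H(L) is a SKL'' is read as: A(S)×S is a non-trivial K-subloop of H(L). With an arbitrary K-subloop the ''only if'' fails for L = S = Z_3 (β: x ↦ −x, α = id). That the conditions imply H(L) and L are SKLs is proved as stated. *)

(* Defs.v *)
From mathcomp Require Import all_boot.
From mathcomp Require Import boolp classical_sets.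

Set Implicit Arguments.
Unset Strict Implicit.
Unset Printing Implicit Defensive.

Local Open Scope classical_set_scope.

Declare Scope loop_scope.
Delimit Scope loop_scope with loop.
Local Open Scope loop_scope.

(* Loops, possibly infinite, in the equational presentation: [ldiv a b] is the
   unique x with a * x = b and [rdiv b a] the unique y with y * a = b. *)
Record loop := Loop {
  carrier :> Type;
  lmul : carrier -> carrier -> carrier;
  lone : carrier;
  ldiv : carrier -> carrier -> carrier;
  rdiv : carrier -> carrier -> carrier;
  lmul1 : forall x, lmul lone x = x;
  lmulr1 : forall x, lmul x lone = x;
  ldivK : forall a b, lmul a (ldiv a b) = b;
  lmulK : forall a x, ldiv a (lmul a x) = x;
  rdivK : forall a b, lmul (rdiv b a) a = b;
  rmulK : forall a y, rdiv (lmul y a) a = y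
}.
Arguments lone {l}.

Notation "x * y" := (lmul x y) : loop_scope.
Notation "1" := lone : loop_scope.

Definition two_sided_inverses (L : loop) :=
  forall x : L, exists y : L, x * y = 1 /\ y * x = 1.

(* The right inverse; it is the two-sided inverse of x as soon as x has one. *)
Definition J (L : loop) (x : L) : L := ldiv x 1.

Record automorphism (L : loop) := Automorphism {
  aut_fun :> L -> L;
  aut_inv_fun : L -> L;
  aut_funK : cancel aut_fun aut_inv_fun;
  aut_inv_funK : cancel aut_inv_fun aut_fun;
  aut_morph : {morph aut_fun : x y / x * y}
}.

Lemma aut_ext (L : loop) (a b : automorphism L) : a =1 b -> a = b.
Proof.
case: a b => [f f' fK f'K fM] [g g' gK g'K gM] /= /funext fg.
subst g; have E : f' = g'.
  by apply: funext => x; rewrite -[in LHS](g'K x) fK.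
by subst g'; congr Automorphism; apply: Prop_irrelevance.
Qed.

Section AutomorphismGroup.
Variable L : loop.
Implicit Types a b : automorphism L.

Definition aut_id : automorphism L :=
  @Automorphism L id id (fun=> erefl) (fun=> erefl) (fun _ _ => erefl).

Lemma aut_inv_morph a : {morph aut_inv_fun a : x y / x * y}.
Proof.
move=> x y.
by rewrite -{1}(aut_inv_funK a x) -{1}(aut_inv_funK a y) -aut_morph aut_funK.
Qed.

Definition aut_inv a : automorphism L :=
  Automorphism (aut_inv_funK a) (aut_funK a) (aut_inv_morph a).

Lemma aut_mul_morph a b : {morph b \o a : x y / x * y}.
Proof. by move=> x y; rewrite /= !aut_morph. Qed.

(* Mappings are written on the right: first a, then b. *)
Definition aut_mul a b : automorphism L :=
  Automorphism (can_comp (aut_funK b) (aut_funK a))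
               (can_comp (aut_inv_funK a) (aut_inv_funK b))
               (aut_mul_morph a b).
End AutomorphismGroup.

Section Holomorph.
Variable L : loop.
Implicit Types p q : automorphism L * L.

Definition hmul p q := (aut_mul p.1 q.1, q.1 p.2 * q.2).
Definition hone : automorphism L * L := (aut_id L, 1).
Definition hldiv p q :=
  let b := aut_mul (aut_inv p.1) q.1 in (b, ldiv (b p.2) q.2).
Definition hrdiv p q :=
  (aut_mul p.1 (aut_inv q.1), aut_inv q.1 (rdiv p.2 q.2)).

Lemma aut1 (a : automorphism L) : a 1 = 1.
Proof.
have E : a 1 * a 1 = a 1 * 1 by rewrite -aut_morph lmul1 lmulr1.
by rewrite -[LHS](lmulK (a 1)) E lmulK.
Qed.

Lemma hmul1 p : hmul hone p = p.
Proof. by case: p => a x; congr pair; [apply: aut_ext | rewrite aut1 lmul1]. Qed.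

Lemma hmulr1 p : hmul p hone = p.
Proof. by case: p => a x; congr pair; [apply: aut_ext | rewrite lmulr1]. Qed.

Lemma hldivK p q : hmul p (hldiv p q) = q.
Proof.
case: p q => a x [c z]; congr pair; last by rewrite ldivK.
by apply: aut_ext => y /=; rewrite aut_funK.
Qed.

Lemma hmullK p q : hldiv p (hmul p q) = q.
Proof.
case: p q => a x [c z]; congr pair; last by rewrite /= aut_inv_funK lmulK.
by apply: aut_ext => y /=; rewrite aut_inv_funK.
Qed.

Lemma hrdivK p q : hmul (hrdiv q p) p = q.
Proof.
case: p q => a x [c z]; congr pair; last by rewrite /= aut_inv_funK rdivK.
by apply: aut_ext => y /=; rewrite aut_inv_funK.
Qed.

Lemma hmulrK p q : hrdiv (hmul q p) p = q.
Proof.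
case: p q => a x [c z]; congr pair; last by rewrite /= rmulK aut_funK.
by apply: aut_ext => y /=; rewrite aut_funK.
Qed.

Definition holomorph : loop :=
  Loop hmul1 hmulr1 hldivK hmullK hrdivK hmulrK.
End Holomorph.

Definition nucleus (L : loop) : set L :=
  [set a | forall x y : L, a * (x * y) = (a * x) * y /\
                           x * (a * y) = (x * a) * y /\
                           x * (y * a) = (x * y) * a].
Definition centrum (L : loop) : set L := [set a | forall x : L, a * x = x * a].
Definition center (L : loop) : set L := @nucleus L `&` @centrum L.

Definition central_holomorph (L : loop) :=
  forall (x : L) (a : automorphism L),
    center (J x * a x) \/ center (a x * J x).

Record subloop (L : loop) (S : set L) : Prop := Subloop {
  subloop1 : S 1;
  subloopM : forall x y, S x -> S y -> S (x * y);
  subloop_ldiv : forall x y, S x -> S y -> S (ldiv x y);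
  subloop_rdiv : forall x y, S x -> S y -> S (rdiv x y)
}.

Section SubloopLoop.
Variables (L : loop) (S : set L) (hS : subloop S).
Implicit Types u v : {x : L | S x}.

Definition smul u v : {x : L | S x} :=
  exist _ (sval u * sval v) (subloopM hS (svalP u) (svalP v)).
Definition sone : {x : L | S x} := exist _ 1 (subloop1 hS).
Definition sldiv u v : {x : L | S x} :=
  exist _ (ldiv (sval u) (sval v)) (subloop_ldiv hS (svalP u) (svalP v)).
Definition srdiv u v : {x : L | S x} :=
  exist _ (rdiv (sval u) (sval v)) (subloop_rdiv hS (svalP u) (svalP v)).

Lemma sval_ext u v : sval u = sval v -> u = v.
Proof. by case: u v => x Sx [y Sy] /= E; apply: eq_exist. Qed.

Lemma smul1 u : smul sone u = u.
Proof. by apply: sval_ext; rewrite /= lmul1. Qed.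
Lemma smulr1 u : smul u sone = u.
Proof. by apply: sval_ext; rewrite /= lmulr1. Qed.
Lemma sldivK u v : smul u (sldiv u v) = v.
Proof. by apply: sval_ext; rewrite /= ldivK. Qed.
Lemma smullK u v : sldiv u (smul u v) = v.
Proof. by apply: sval_ext; rewrite /= lmulK. Qed.
Lemma srdivK u v : smul (srdiv v u) u = v.
Proof. by apply: sval_ext; rewrite /= rdivK. Qed.
Lemma smulrK u v : srdiv (smul v u) u = v.
Proof. by apply: sval_ext; rewrite /= rmulK. Qed.

Definition subloop_loop : loop :=
  Loop smul1 smulr1 sldivK smullK srdivK smulrK.
End SubloopLoop.

Inductive mlt (L : loop) : (L -> L) -> Prop :=
| mlt_left (a : L) : mlt (fun x => a * x)
| mlt_right (a : L) : mlt (fun x => x * a)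
| mlt_id : mlt id
| mlt_comp (f g : L -> L) : mlt f -> mlt g -> mlt (f \o g)
| mlt_inv (f g : L -> L) : mlt f -> cancel f g -> cancel g f -> mlt g.

Definition inner_mapping (L : loop) (f : L -> L) := mlt f /\ f 1 = 1.

Definition A_loop (L : loop) :=
  forall f : L -> L, inner_mapping f -> exists a : automorphism L, f =1 a.

Definition AIP (L : loop) :=
  two_sided_inverses L /\ forall x y : L, J (x * y) = J x * J y.

Definition K_loop (L : loop) := A_loop L /\ AIP L.

(* L is Smarandache for the class P, S being a subloop that witnesses it. *)
Definition smarandache_with (P : loop -> Prop) (L : loop) (S : set L) :=
  exists hS : subloop S, (exists x, S x /\ x <> 1) /\ P (subloop_loop hS).

Definition smarandache (P : loop -> Prop) (L : loop) :=
  exists S : set L, smarandache_with P S.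

Definition SAL_with (L : loop) (S : set L) := smarandache_with A_loop S.
Definition SKL_with (L : loop) (S : set L) := smarandache_with K_loop S.
Definition SKL (L : loop) := smarandache K_loop L.

Definition smarandache_aut (L : loop) (S : set L) : set (automorphism L) :=
  [set a | forall s, S s -> S (a s)].

(* A(S) x S. The Smarandache property of the holomorph relative to the given S
   is witnessed by this part: an unrelated nontrivial K-subloop says nothing
   about A(S), e.g. for L = S = Z/3 the holomorph S_3 contains the K-loop Z/3,
   although x |-> -x does not fix S pointwise. *)
Definition holomorph_over (L : loop) (S : set L) : set (holomorph L) :=
  smarandache_aut S `*` S.

(* Main.v *)
Require Import Defs.
From mathcomp Require Import all_boot.
From mathcomp Require Import boolp classical_sets.

(** Both sides of the equivalence say that the twisting in the holomorph is
    invisible over S: every automorphism preserving S fixes S pointwise, these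
    automorphisms commute, and inversion is multiplicative on S (the predicate
    [untwisted]).

    For the displayed identity J(x b^-1) J(y) = J(x . y a^-1), put x = 1: this
    leaves J(y) = J(y a^-1), and J is injective, so a fixes S pointwise
    ([compatible_untwisted]).  For the automorphic inverse property of the
    holomorph, compare the two components: the first says that inversion is
    multiplicative in A(S), so that A(S) is abelian, and the second, at the
    elements (a, 1) and (1, y), again says J(y) = J(y a^-1)
    ([AIP_untwisted]).

    Conversely, in the untwisted case the part A(S) x S of the holomorph is the
    direct product of an abelian group and a loop S with the automorphic inverse
    property.  An element of its multiplication group is a translation of A(S)
    times an element of the multiplication group of S ([mlt_untwisted]); if it
    fixes the identity, the translation is trivial and the other factor is an
    inner mapping of S, hence an automorphism since S is an A-loop.  So A(S) x S
    is a K-loop, and S itself is a K-subloop of L. *)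

Set Implicit Arguments.
Unset Strict Implicit.
Unset Printing Implicit Defensive.

Local Open Scope classical_set_scope.
Local Open Scope loop_scope.

(** * Inverses in loops, subloops and holomorphs *)

Lemma mulJ (L : loop) (x : L) : x * J x = 1.
Proof. exact: ldivK. Qed.

Lemma Jmul (L : loop) (hinv : two_sided_inverses L) (x : L) : J x * x = 1.
Proof. by case: (hinv x) => y [xy yx]; rewrite /J -{1}xy lmulK. Qed.

Lemma JK (L : loop) (hinv : two_sided_inverses L) : involutive (@J L).
Proof. by move=> x; rewrite {1}/J -(Jmul hinv x) lmulK. Qed.

Lemma J1 (L : loop) : J (1 : L) = 1.
Proof. by rewrite -[LHS]lmul1 mulJ. Qed.

Lemma subloop_two_sided_inverses (L : loop) (S : set L) (hS : subloop S) :
  two_sided_inverses L -> two_sided_inverses (subloop_loop hS).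
Proof.
move=> hinv u; exists (J u); split; first exact: mulJ.
by apply: sval_ext; apply: Jmul.
Qed.

Lemma aut_mulA (L : loop) : associative (@aut_mul L).
Proof. by move=> a b c; apply: aut_ext. Qed.

Lemma aut_mul1 (L : loop) : left_id (aut_id L) (@aut_mul L).
Proof. by move=> a; apply: aut_ext. Qed.

Lemma aut_mulr1 (L : loop) : right_id (aut_id L) (@aut_mul L).
Proof. by move=> a; apply: aut_ext. Qed.

Lemma aut_mulV (L : loop) (a : automorphism L) :
  aut_mul (aut_inv a) a = aut_id L.
Proof. by apply: aut_ext => x; apply: aut_inv_funK. Qed.

Lemma aut_invK (L : loop) : involutive (@aut_inv L).
Proof. by move=> a; apply: aut_ext. Qed.

Lemma aut_invM (L : loop) (a b : automorphism L) :
  aut_inv (aut_mul a b) = aut_mul (aut_inv b) (aut_inv a).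
Proof. exact: aut_ext. Qed.

Lemma holomorph_J (L : loop) (p : holomorph L) :
  J p = (aut_inv p.1, J (aut_inv p.1 p.2)).
Proof. by congr pair; apply: aut_mulr1. Qed.

(** * The untwisted case *)

Definition untwisted (L : loop) (S : set L) :=
  [/\ forall (a : automorphism L) s, smarandache_aut S a -> S s -> a s = s,
      forall a b : automorphism L, smarandache_aut S a ->
        smarandache_aut S b -> aut_mul a b = aut_mul b a
    & forall x y : L, S x -> S y -> J (x * y) = J x * J y].

Lemma smarandache_aut_id (L : loop) (S : set L) : smarandache_aut S (aut_id L).
Proof. by []. Qed.

Lemma smarandache_aut_mul (L : loop) (S : set L) (a b : automorphism L) :
  smarandache_aut S a -> smarandache_aut S b -> smarandache_aut S (aut_mul a b).
Proof. by move=> Aa Ab s Ss; apply: Ab; apply: Aa. Qed.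

Lemma untwisted_inv (L : loop) (S : set L) (a : automorphism L) (s : L) :
  untwisted S -> smarandache_aut S a -> S s -> aut_inv a s = s.
Proof.
by case=> fixS _ _ Aa Ss; rewrite -{1}(fixS a s Aa Ss) /= aut_funK.
Qed.

(** In general an automorphism may map an infinite S onto a proper part of
    itself; pointwise fixing is what makes A(S) closed under inverses. *)
Lemma untwisted_aut_inv (L : loop) (S : set L) (a : automorphism L) :
  untwisted S -> smarandache_aut S a -> smarandache_aut S (aut_inv a).
Proof. by move=> uS Aa s Ss; rewrite (untwisted_inv uS). Qed.

(** The choice x = 1 isolates the pointwise fixing, and a = b = id turns the
    identity into the multiplicativity of inversion on S. *)
Lemma compatible_untwisted (L : loop) (S : set L) :
  two_sided_inverses L -> S 1 ->
  (forall a b : automorphism L, smarandache_aut S a -> smarandache_aut S b ->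
      (forall x y : L, S x -> S y ->
         J (aut_inv b x) * J y = J (x * aut_inv a y)) /\
      aut_mul a b = aut_mul b a) <-> untwisted S.
Proof.
move=> hinv S1; split=> [comp | uS a b Aa Ab].
  split=> [a s Aa Ss | a b Aa Ab | x y Sx Sy].
  - have [+ _] := comp a (aut_id L) Aa (@smarandache_aut_id _ S).
    move=> /(_ 1 s S1 Ss); rewrite aut1 J1 !lmul1 => /(can_inj (JK hinv)) E.
    by rewrite {1}E /= aut_inv_funK.
  - by have [] := comp a b Aa Ab.
  - have [+ _] := comp _ _ (@smarandache_aut_id _ S) (@smarandache_aut_id _ S).
    by move=> ->.
have [_ comm JM] := uS; split; last exact: comm.
by move=> x y Sx Sy; rewrite !(untwisted_inv uS) // JM.
Qed.

(** * The holomorph over S has the AIP only in the untwisted case *)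

(** The pairs (a, 1) and (id, s) multiply to (a, s) without twisting, whereas
    the inverse of (a, s) applies a^-1 to s: the identity can only hold if a
    fixes s.  Pairs (a, 1), (b, 1) give commutativity, and pairs (id, x),
    (id, y) the property on S. *)
Lemma AIP_untwisted (L : loop) (S : set L) (hH : subloop (holomorph_over S)) :
  two_sided_inverses L -> AIP (subloop_loop hH) -> untwisted S.
Proof.
move=> hinv [_ HJM].
have JM (p q : holomorph L) : holomorph_over S p -> holomorph_over S q ->
    J (p * q) = J p * J q.
  by move=> Hp Hq; apply: (congr1 sval (HJM (exist _ p Hp) (exist _ q Hq))).
have [_ S1] := subloop1 hH.
have A1 := @smarandache_aut_id _ S.
split=> [a s Aa Ss | a b Aa Ab | x y Sx Sy].
- have := JM (a, 1) (aut_id L, s) (conj Aa S1) (conj A1 Ss).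
  rewrite !holomorph_J => /(congr1 snd) /=.
  rewrite lmul1 [aut_inv_fun a 1](aut1 (aut_inv a)) J1 lmul1.
  by move=> /(can_inj (JK hinv)) E; rewrite -{1}E aut_inv_funK.
- have E : aut_inv (aut_mul a b) = aut_mul (aut_inv a) (aut_inv b).
    have := JM (a, 1) (b, 1) (conj Aa S1) (conj Ab S1).
    by rewrite !holomorph_J => /(congr1 fst).
  by rewrite -[LHS]aut_invK E aut_invM !aut_invK.
- have := JM (aut_id L, x) (aut_id L, y) (conj A1 Sx) (conj A1 Sy).
  by rewrite !holomorph_J => /(congr1 snd).
Qed.

Lemma untwisted_AIP (L : loop) (S : set L) (hS : subloop S) :
  two_sided_inverses L -> untwisted S -> AIP (subloop_loop hS).
Proof.
move=> hinv [_ _ JM]; split; first exact: subloop_two_sided_inverses.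
by move=> u v; apply: sval_ext; apply: JM; apply: svalP.
Qed.

(** * In the untwisted case the holomorph over S is a direct product *)

Lemma mlt_bijective (M : loop) (f : M -> M) : mlt f -> bijective f.
Proof.
elim=> {f} [a | a | | f g _ bf _ bg | f g _ _ fK gK].
- by exists (ldiv a) => x; [apply: lmulK | apply: ldivK].
- by exists (fun x => rdiv x a) => x; [apply: rmulK | apply: rdivK].
- by exists id.
- exact: bij_comp.
- by exists f.
Qed.

Section DirectProduct.
Variables (L : loop) (S : set L) (hS : subloop S) (uS : untwisted S).

Lemma holomorph_over_subloop : subloop (holomorph_over S).
Proof.
have inv a := @untwisted_aut_inv L S a uS.
have mul := @smarandache_aut_mul L S.
split=> [|p q [Ap Sp] [Aq Sq]|p q [Ap Sp] [Aq Sq]|p q [Ap Sp] [Aq Sq]].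
- by split; [apply: smarandache_aut_id | apply: subloop1].
- by split; [apply: mul | apply: subloopM => //; apply: Aq].
- split; first by apply: mul => //; apply: inv.
  by apply: subloop_ldiv => //; apply: (mul _ _ (inv _ Ap) Aq).
- split; first by apply: mul => //; apply: inv.
  by apply: inv => //; apply: subloop_rdiv.
Qed.

Let H := subloop_loop holomorph_over_subloop.
Let T := subloop_loop hS.

Definition fst_part (u : H) : automorphism L := (sval u).1.
Definition snd_part (u : H) : T := exist _ (sval u).2 (svalP u).2.

Lemma fst_partP (u : H) : smarandache_aut S (fst_part u).
Proof. by case: (svalP u). Qed.

Definition pair_part (a : automorphism L) (Aa : smarandache_aut S a) (s : T) : H :=
  exist _ (a, sval s) (conj Aa (svalP s)).

Lemma parts_inj (u v : H) :
  fst_part u = fst_part v -> snd_part u = snd_part v -> u = v.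
Proof.
move=> E1 /(congr1 sval) E2; apply: sval_ext; move: E1 E2.
rewrite /fst_part /=.
by case: (sval u) (sval v) => [a x] [b y] /= -> ->.
Qed.

Lemma fst_partM (u v : H) : fst_part (u * v) = aut_mul (fst_part u) (fst_part v).
Proof. by []. Qed.

Lemma snd_partM (u v : H) : snd_part (u * v) = snd_part u * snd_part v.
Proof.
have [fixS _ _] := uS.
by apply: sval_ext; rewrite /= fixS; [| case: (svalP v) | case: (svalP u)].
Qed.

Lemma snd_part_pair a (Aa : smarandache_aut S a) s :
  snd_part (pair_part Aa s) = s.
Proof. exact: sval_ext. Qed.

(** Left and right translations of the first factor agree because A(S) is
    abelian, so a single translation suffices. *)
Lemma mlt_untwisted (f : H -> H) : mlt f ->
  exists2 c : automorphism L, smarandache_aut S c & exists2 g : T -> T, mlt g &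
    forall u, fst_part (f u) = aut_mul c (fst_part u) /\
              snd_part (f u) = g (snd_part u).
Proof.
have [_ comm _] := uS.
elim=> {f} [v | v | | f f' _ [c Ac [g mg fE]] _ [c' Ac' [g' mg' fE']]
           | f f' _ [c Ac [g mg fE]] fK f'K].
- exists (fst_part v); first exact: fst_partP.
  exists (fun s => snd_part v * s); first exact: mlt_left.
  by move=> u; rewrite snd_partM.
- exists (fst_part v); first exact: fst_partP.
  exists (fun s => s * snd_part v); first exact: mlt_right.
  by move=> u; rewrite snd_partM fst_partM comm //; apply: fst_partP.
- exists (aut_id L) => //; exists id; first exact: mlt_id.
  by move=> u; rewrite aut_mul1.
- exists (aut_mul c c'); first exact: smarandache_aut_mul.
  exists (g \o g'); first exact: mlt_comp.
  move=> u /=; have [-> ->] := fE (f' u); have [-> ->] := fE' u.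
  by rewrite aut_mulA.
- exists (aut_inv c); first exact: untwisted_aut_inv.
  have [g' gK g'K] := mlt_bijective mg.
  exists g'; first exact: (mlt_inv mg).
  move=> v; have [E1 E2] := fE (f' v); rewrite f'K in E1 E2.
  by rewrite E1 E2 gK aut_mulA aut_mulV aut_mul1.
Qed.

Definition act_snd (r : T -> T) (u : H) : H :=
  pair_part (fst_partP u) (r (snd_part u)).

Lemma act_snd_can (r r' : T -> T) :
  cancel r r' -> cancel (act_snd r) (act_snd r').
Proof. by move=> rK u; apply: parts_inj; rewrite // !snd_part_pair rK. Qed.

Lemma act_snd_morph (t : automorphism T) : {morph act_snd t : u v / u * v}.
Proof.
move=> u v; apply: parts_inj => //.
by rewrite snd_partM !snd_part_pair snd_partM aut_morph.
Qed.

Definition aut_snd (t : automorphism T) : automorphism H :=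
  Automorphism (act_snd_can (aut_funK t)) (act_snd_can (aut_inv_funK t))
    (act_snd_morph t).

Lemma holomorph_over_A_loop : A_loop T -> A_loop H.
Proof.
move=> AT f [mf f1]; have [c Ac [g mg fE]] := mlt_untwisted mf.
have [E1 E2] := fE 1; rewrite f1 in E1 E2.
(* Evaluation at the identity kills the translation and makes g inner. *)
have c1 : c = aut_id L by rewrite -[LHS]aut_mulr1; symmetry.
have one2 : snd_part 1 = 1 by apply: sval_ext.
rewrite one2 in E2; have [t gt] := AT g (conj mg (esym E2)).
exists (aut_snd t) => u; have [F1 F2] := fE u.
apply: parts_inj; first by rewrite F1 c1 aut_mul1.
by rewrite F2 gt snd_part_pair.
Qed.

Lemma fst_partJ (u : H) : fst_part (J u) = aut_inv (fst_part u).
Proof. exact: aut_mulr1. Qed.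

Lemma snd_partJ (u : H) : snd_part (J u) = J (snd_part u).
Proof.
case: (svalP u) => Au Su; apply: sval_ext.
transitivity (J (sval u : holomorph L)).2 => //.
by rewrite holomorph_J [LHS]/= [X in J X](untwisted_inv uS Au Su).
Qed.

Lemma holomorph_over_AIP : AIP T -> AIP H.
Proof.
have [_ comm _] := uS => -[invT JM].
split=> [u | u v].
- exists (J u); split; first exact: mulJ.
  apply: parts_inj; first by rewrite fst_partM fst_partJ aut_mulV.
  by rewrite snd_partM snd_partJ Jmul //; apply: sval_ext.
- have inv (w : H) := untwisted_aut_inv uS (fst_partP w).
  apply: parts_inj.
    by rewrite fst_partM !fst_partJ fst_partM aut_invM comm.
  by rewrite snd_partM !snd_partJ snd_partM JM.
Qed.

End DirectProduct.

Theorem theorem3p19 (L : loop) (S : set L)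
    (hinv : two_sided_inverses L)
    (hS : SAL_with S)
    (hcentral : central_holomorph L) :
  let compatible :=
    forall a b : automorphism L, smarandache_aut S a -> smarandache_aut S b ->
      (forall x y : L, S x -> S y ->
         J (aut_inv b x) * J y = J (x * aut_inv a y)) /\
      aut_mul a b = aut_mul b a in
  (SKL_with (holomorph_over S) <-> compatible) /\
  (compatible -> SKL (holomorph L) /\ SKL L).
Proof.
move=> compatible; have [subS [[x [Sx x1]] AS]] := hS.
have [cu uc] : compatible <-> untwisted S.
  exact: compatible_untwisted hinv (subloop1 subS).
have kloop : compatible -> SKL_with (holomorph_over S).
  move=> /cu uS; exists (holomorph_over_subloop subS uS); split.
    by exists (aut_id L, x); split; [split | move=> /(congr1 snd)/x1].
  split; first exact: holomorph_over_A_loop.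
  by apply: holomorph_over_AIP; apply: untwisted_AIP.
split; first split=> // [[hH [_ [_ aip]]]].
  by apply: uc; apply: AIP_untwisted hinv aip.
move=> comp; split; first by exists (holomorph_over S); apply: kloop.
exists S, subS; split; first by exists x.
by split=> //; apply: untwisted_AIP => //; apply: cu.
Qed.
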